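(* For every $\eta>0$ there exists $K>0$ such that every triangle-free graph $G$ on $n\ge 1$ vertices whose degree sequence has geometric mean $\left(\prod_{v\in V(G)}\deg(v)\right)^{1/n}$ at least $K$ contains a semi-bipartite induced subgraph of average degree at least \[ (2-\eta)\,\frac1n\sum_{v\in V(G)}\log\deg(v). \] (That is, $G$ contains a semi-bipartite induced subgraph of average degree at least $(2+o(1))\frac1n\sum_{v\in V(G)}\log\deg(v)$, where the $o(1)$ term tends to zero as the geometric mean of the degree sequence of $G$ tends to infinity.)
   Context: Graphs are finite and simple; $\log$ is the natural logarithm. A semi-bipartite induced subgraph of a graph $G$ is a subgraph $H$ of $G$ with vertex set $A\cup B$ consisting of all edges of $G$ between two disjoint subsets $A,B\subset V(G)$ such that $A$ is an independent set of $G$ (edges of $G$ inside $B$ are not included in $H$). Its average degree is $\frac{2}{|A|+|B|}e_G(A,B)$, where $e_G(A,B)$ is the number of edges of $G$ with one endpoint in $A$ and one endpoint in $B$. *)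

(* Defs.v *)
From HB Require Import structures.
From mathcomp Require Import all_boot all_order all_algebra.
From mathcomp Require Import reals exp.

Set Implicit Arguments.
Unset Strict Implicit.
Unset Printing Implicit Defensive.

Import Order.TTheory GRing.Theory Num.Theory.

Local Open Scope ring_scope.

Section Graphs.
Variables (V : finType) (adj : rel V).

Definition simple_graph : Prop := symmetric adj /\ irreflexive adj.

Definition triangle_free : Prop :=
  forall x y z : V, ~ [/\ adj x y, adj y z & adj x z].

Definition deg (v : V) : nat := #|[set w | adj v w]|.

Definition independent (A : {set V}) : Prop :=
  forall x y : V, x \in A -> y \in A -> ~~ adj x y.

(* Edges are unordered pairs, so an edge is counted once even when A and B
   overlap. *)
Definition edges_between (A B : {set V}) : {set {set V}} :=
  [set [set x; y] | x in A, y in B & adj x y].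

(* The subgraph with vertex set A :|: B and edge set edges_between A B. A graph
   has at least one vertex here, so that its average degree makes sense. *)
Definition semi_bipartite_induced (A B : {set V}) : Prop :=
  [/\ [disjoint A & B], independent A & A :|: B != set0].

Definition avg_degree (R : realType) (A B : {set V}) : R :=
  2 / (#|A| + #|B|)%:R * #|edges_between A B|%:R.

Definition geom_mean_deg (R : realType) : R :=
  (\prod_(v : V) (deg v)%:R) `^ (#|V|%:R^-1).

(* ln takes a junk value at 0, but no degree is 0 once the geometric mean of
   the degrees is positive. *)
Definition mean_log_deg (R : realType) : R :=
  #|V|%:R^-1 * \sum_(v : V) ln (deg v)%:R.

End Graphs.

(* Main.v *)
(* Take A to be a random independent set I from the hard-core model with a
   constant fugacity l depending only on eta, and B its complement, so that the
   number of edges between A and B is the sum of the degrees over I. Fix a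
   vertex v and condition on I outside the closed neighbourhood of v. Because
   the neighbourhood of v is independent, what remains is the hard-core model
   on a star centred at v with the k neighbours of v that are not blocked, and
   with Z = (1 + l)^k, up to factors 1 + l,
     E[ l deg(v) 1(v in I) + |I :&: N(v)| ] >= l^2 deg(v) / Z + ln Z
                                            >= 1 + ln deg(v) + 2 ln l.
   In the sum over v, the left-hand side becomes (1 + l) times the expected sum
   of degrees over I. *)
Require Import Defs.
From HB Require Import structures.
From mathcomp Require Import all_boot all_order all_algebra.
From mathcomp Require Import reals exp sequences.
From mathcomp Require Import ring lra.
Import Order.TTheory GRing.Theory Num.Theory.
Local Open Scope ring_scope.

(** * Sums over subsets and the inequality for a single star *)

Lemma sum_subset_expr (R : comNzRingType) (V : finType) (U : {set V}) (x : R) :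
  \sum_(S : {set V} | S \subset U) x ^+ #|S| = (1 + x) ^+ #|U|.
Proof.
(* Expand the product of [x + 1] over [U] and [0 + 1] off [U]: a set that leaves [U] picks up a
   factor 0. *)
have := @bigA_distr R 0 1 *%R +%R V
  (fun i => if i \in U then x else 0) (fun=> 1).
rewrite (eq_bigr (fun i => if i \in U then 1 + x else 1)); last first.
  by move=> i _ /=; case: ifP; rewrite ?add0r // => _; rewrite addrC.
rewrite -big_mkcond prodr_const => ->.
rewrite big_mkcond; apply: eq_bigr => S _; case: ifPn => [/subsetP SU|].
  rewrite -prodr_const big_mkcond; apply: eq_bigr => i _.
  by case: ifP => // /SU ->.
case/subsetPn => i iS iU; rewrite (bigD1 i) //= iS (negbTE iU) mul0r //.
Qed.

Lemma sum_subset_card_expr (R : comNzRingType) (V : finType) (U : {set V})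
    (x : R) :
  (1 + x) * (\sum_(S : {set V} | S \subset U) x ^+ #|S| * #|S|%:R) =
  #|U|%:R * x * (1 + x) ^+ #|U|.
Proof.
(* Differentiate the generating function [(1 + x) ^+ #|U|]. *)
have /(congr1 (fun p : {poly R} => p^`().[x])) :=
  @sum_subset_expr {poly R} V U 'X.
rewrite linear_sum /= horner_sum deriv_exp !derivE add0r mul1r.
rewrite hornerMn horner_exp !hornerE => E.
transitivity ((1 + x) * x *
    \sum_(S : {set V} | S \subset U) ('X^(#|S|))^`().[x]).
  rewrite -mulrA; congr (_ * _); rewrite mulr_sumr; apply: eq_bigr => S _.
  rewrite derivXn hornerMn hornerXn mulr_natr mulrnAr.
  by case: #|S| => [|m]; rewrite ?mulr0n // -exprS.
rewrite E; case: #|U| => [|m]; rewrite ?mulr0n /=; first by rewrite mulr0 !mul0r.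
by rewrite -mulr_natl exprS; ring.
Qed.

(** This is the local bound multiplied by the partition function [l + (1 + l) ^+ k] of a star: the
    term [l] is the centre alone, the power is the sum over sets of leaves. On the right, [d] is the
    full degree of the centre and the last term is the unnormalized mean number of occupied
    leaves. *)
Lemma star_bound (R : realType) (l d : R) (k : nat) : 0 < l -> 0 < d ->
  (l + (1 + l) ^+ k) * ((1 + ln d + 2 * ln l) / (1 + l) ^+ 2) <=
  l * (l * d) + k%:R * l * (1 + l) ^+ k / (1 + l).
Proof.
move=> l0 d0; set Z := (1 + l) ^+ k.
have l1 : 0 < 1 + l by lra.
have Z1 : 1 <= Z by apply: exprn_ege1; lra.
have Z0 : 0 < Z by lra.
have lnZ : ln Z <= k%:R * l.
  rewrite lnXn // -[leLHS]mulr_natl ler_wpM2l ?ler0n //.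
  by apply: le_ln1Dx; lra.
(* [1 + ln y <= y] at [y = l ^+ 2 * d / Z]; the [ln Z] terms cancel. *)
have key : 1 + ln d + 2 * ln l <= l ^+ 2 * d / Z + k%:R * l.
  have x0 : 0 < l ^+ 2 * d / Z by rewrite divr_gt0 // mulr_gt0 // exprn_gt0.
  have := @le_ln1Dx R (l ^+ 2 * d / Z - 1).
  rewrite addrCA subrr addr0 ln_div ?posrE // ?mulr_gt0 ?exprn_gt0 //.
  rewrite lnM ?posrE ?exprn_gt0 // lnXn // -mulr_natl.
  by move=> /(_ ltac:(lra)); lra.
rewrite mulrC -ler_pdivlMr; last by lra.
set RHS := l * _ + _.
have R0 : 0 <= RHS.
  by rewrite addr_ge0 // ?mulr_ge0 // ?invr_ge0; lra.
(* Since [1 <= Z], the partition function [l + Z] is at most [(1 + l) * Z]. *)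
apply: (@le_trans _ _ (RHS / ((1 + l) * Z))); last first.
  rewrite ler_wpM2l // lef_pV2 ?posrE; nra.
rewrite ler_pdivrMr ?exprn_gt0 //; apply: le_trans key _.
have -> : RHS / ((1 + l) * Z) * (1 + l) ^+ 2 =
    (l ^+ 2 * d / Z) * (1 + l) + k%:R * l.
  by rewrite /RHS; field; rewrite ?gt_eqF.
have : 0 <= l ^+ 2 * d / Z by rewrite divr_ge0 ?mulr_ge0 ?exprn_ge0 //; lra.
nra.
Qed.

(** * The hard-core model on a triangle-free graph *)

Section TriangleFree.
Variables (V : finType) (adj : rel V).
Hypotheses (simple : simple_graph adj) (tf : triangle_free adj).

Definition nbhd (v : V) : {set V} := [set w | adj v w].

Definition closed_nbhd (v : V) : {set V} := v |: nbhd v.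

Definition indep (A : {set V}) : bool :=
  [forall x in A, forall y in A, ~~ adj x y].

Definition free_nbhd (v : V) (J : {set V}) : {set V} :=
  [set u in nbhd v | [forall w in J, ~~ adj u w]].

Lemma indepP (A : {set V}) : reflect (independent adj A) (indep A).
Proof.
apply: (iffP forall_inP) => [H x y xA yA|H x xA].
  by have /forall_inP/(_ _ yA) := H _ xA.
by apply/forall_inP => y yA; apply: H.
Qed.

Lemma indepS (A B : {set V}) : A \subset B -> indep B -> indep A.
Proof.
by move=> /subsetP AB /indepP iB; apply/indepP => x y /AB xB /AB; apply: iB.
Qed.

Lemma free_nbhdS v J : free_nbhd v J \subset closed_nbhd v.
Proof. by apply/subsetP => u; rewrite !inE => /andP[->]; rewrite orbT. Qed.

(** Triangle-freeness enters here: neighbours of [v] are pairwise non-adjacent, so they are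
    constrained only by [v] and by [J]. The centre is never blocked, as [J] avoids its
    neighbourhood. *)
Lemma indep_star v (J S : {set V}) :
  indep J -> J :&: closed_nbhd v = set0 -> S \subset closed_nbhd v ->
  indep (S :|: J) = (S == [set v]) || (S \subset free_nbhd v J).
Proof.
have [sym irr] := simple; move=> iJ dJ /subsetP SN.
have vJ w : w \in J -> ~~ adj v w.
  move=> wJ; apply/negP => vw; have /setP/(_ w) := dJ.
  by rewrite !inE wJ vw orbT.
apply/indepP/idP => [iS|].
  have SU u : u \in S -> u != v -> u \in free_nbhd v J.
    move=> uS uv; have := SN _ uS; rewrite !inE (negbTE uv) /= => -> /=.
    by apply/forall_inP => w wJ; apply: iS; rewrite inE ?uS ?wJ ?orbT.
  have [vS|vS] := boolP (v \in S); last first.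
    apply/orP; right; apply/subsetP => u uS; apply: SU => //.
    by apply: contraNneq vS => <-.
  apply/orP; left; apply/eqP/setP => u; rewrite inE.
  have [->//|uv] := eqVneq u v.
  apply/negP => uS; have := SN _ uS; rewrite !inE (negbTE uv) /= => vu.
  by have := iS v u; rewrite !inE vS uS vu => /(_ isT isT).
move=> H x y; rewrite !inE.
have aux u w : u \in S -> w \in J -> ~~ adj u w.
  case/orP: H => [/eqP-> /set1P-> /vJ //|/subsetP SU /SU].
  by rewrite inE => /andP[_ /forall_inP]; apply.
case/orP => xS /orP[] yS; last 1 first.
- by move/indepP: iJ; apply.
- case/orP: H => [/eqP SE|/subsetP SU].
    by move: xS yS; rewrite SE !inE => /eqP-> /eqP->; rewrite irr.
  move: (SU _ xS) (SU _ yS); rewrite !inE => /andP[vx _] /andP[vy _].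
  by apply/negP => xy; apply: (tf v x y).
- exact: aux.
- by rewrite sym; apply: aux.
Qed.

(** Conditioning on [J] outside the star: [I] is recovered from its trace [S] on the closed
    neighbourhood, and [indep_star] lists the possible traces. *)
Lemma sum_indep_star (R : nmodType) v (J : {set V}) (F : {set V} -> R) :
  indep J -> J :&: closed_nbhd v = set0 ->
  \sum_(I | indep I && (I :\: closed_nbhd v == J)) F I =
  F (v |: J) + \sum_(S : {set V} | S \subset free_nbhd v J) F (S :|: J).
Proof.
move=> iJ dJ; have [sym irr] := simple.
rewrite (reindex_onto (fun S => S :|: J)
  (fun I => I :&: closed_nbhd v)); last first.
  by move=> I /andP[_ /eqP <-]; rewrite setID.
have vU : v \notin free_nbhd v J by rewrite !inE irr.
rewrite (eq_bigl (fun S => (S == [set v]) || (S \subset free_nbhd v J))).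
  rewrite (bigD1 [set v]) ?eqxx //=; congr (_ + _); apply: eq_bigl => S.
  have [->/=|] := eqVneq S [set v]; last by rewrite andbT.
  by rewrite sub1set (negbTE vU).
move=> S; rewrite setDUl setIUl dJ setU0.
have -> : J :\: closed_nbhd v = J.
  by apply/setDidPl; rewrite -setI_eq0 dJ.
have [SN|SN] := boolP (S \subset closed_nbhd v); last first.
  transitivity false.
    by apply/negP => /andP[_ /eqP SE]; case/negP: SN; apply/setIidPl.
  apply/esym/negP => /orP[/eqP SE|SU]; case/negP: SN.
    by rewrite SE sub1set !inE eqxx.
  exact: subset_trans SU (free_nbhdS v J).
have -> : S :\: closed_nbhd v = set0 by apply/eqP; rewrite setD_eq0.
by rewrite set0U (setIidPl SN) !eqxx !andbT (indep_star v J S).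
Qed.

(* Expectations in the hard-core model are left unnormalized: both sides carry
   the partition function as a factor. *)
Lemma local_occupancy (R : realType) (l : R) v : 0 < l -> (0 < deg adj v)%N ->
  (1 + ln (deg adj v)%:R + 2 * ln l) / (1 + l) ^+ 2 *
    (\sum_(I | indep I) l ^+ #|I|) <=
  \sum_(I | indep I) l ^+ #|I| *
    (l * (deg adj v)%:R * (v \in I)%:R + #|I :&: nbhd v|%:R).
Proof.
move=> l0 d0; set L := _ / _; have [sym irr] := simple.
pose D I := I :\: closed_nbhd v.
rewrite mulr_sumr (partition_big D xpredT) //.
rewrite [leRHS](partition_big D xpredT) //; apply: ler_sum => J _.
(* If no independent set leaves [J] outside the star, both inner sums are empty. *)
case: (pickP (fun I => indep I && (D I == J))) => [I0|none]; last first.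
  by rewrite !big_pred0.
case/andP => iI0 /eqP DJ.
have iJ : indep J by apply: indepS iI0; rewrite -DJ subsetDl.
have dJ : J :&: closed_nbhd v = set0 by apply/eqP; rewrite -DJ /D setI_eq0 disjoints_subset setDE subsetIr.
have vJ : v \notin J.
  by apply/negP => vJ; have /setP/(_ v) := dJ; rewrite !inE vJ eqxx.
have JN : J :&: nbhd v = set0.
  by apply/eqP; rewrite -subset0 -dJ setIS // subsetUr.
rewrite !sum_indep_star // !cardsU1 vJ /= add1n.
have SUD (S : {set V}) : S \subset free_nbhd v J ->
    [/\ #|S :|: J| = (#|S| + #|J|)%N, v \notin S :|: J
       & (S :|: J) :&: nbhd v = S].
  move=> SU; have SN : S \subset nbhd v.
    by apply: subset_trans SU _; apply/subsetP => u; rewrite inE => /andP[].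
  split.
  - rewrite cardsU; suff -> : S :&: J = set0 by rewrite cards0 subn0.
    by apply/eqP; rewrite -subset0 -JN setIC setIS.
  - rewrite inE negb_or vJ andbT; apply/negP => /(subsetP SN).
    by rewrite inE irr.
  - by rewrite setIUl JN setU0; apply/setIidPl.
have -> : (v |: J) :&: nbhd v = set0.
  rewrite setIUl JN setU0; apply/setP => u; rewrite !inE.
  by case: eqP => [->|]; rewrite ?irr.
rewrite cards0 setU11 mulr1 addr0.
under eq_bigr => S /SUD[-> _ _] do rewrite exprD mulrCA mulrA.
under [X in _ <= _ + X]eq_bigr => S /SUD[-> /negbTE -> ->]
  do rewrite mulr0 add0r exprD mulrAC.
rewrite -!mulr_suml sum_subset_expr.
have l1 : 1 + l != 0 by rewrite gt_eqF // addr_gt0.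
have /(canRL (mulKf l1)) -> := sum_subset_card_expr R V (free_nbhd v J) l.
have := star_bound R l (deg adj v)%:R #|free_nbhd v J| l0.
rewrite ltr0n d0 -/L => /(_ isT) /(ler_wpM2r (ltW (exprn_gt0 #|J| l0))).
rewrite exprS [X in X <= _ -> _](_ : _ = L * (l * l ^+ #|J|) +
  (1 + l) ^+ #|free_nbhd v J| * L * l ^+ #|J|); last by ring.
by move=> /le_trans; apply; rewrite le_eqVlt; apply/predU1P; left; field.
Qed.

(** Orient each edge away from [A]. By independence its head lies outside [A], so the unordered pair
    determines the orientation and nothing is counted twice. *)
Lemma card_edges_between_setC (A : {set V}) : independent adj A ->
  #|edges_between adj A (~: A)| = (\sum_(v in A) deg adj v)%N.
Proof.
move=> iA; pose E := [set p : V * V | (p.1 \in A) && adj p.1 p.2].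
have EA p : p \in E -> p.2 \notin A.
  by rewrite inE => /andP[pA]; apply: contraL => /(iA _ _ pA).
have -> : edges_between adj A (~: A) = [set [set p.1; p.2] | p in E].
  apply/setP => e; apply/imset2P/imsetP => [[x y xA]|[[x y] xyE ->]].
    by rewrite !inE => /andP[yA xy] ->; exists (x, y); rewrite // inE xA.
  exists x y => //; first by move: xyE; rewrite inE => /andP[].
  by rewrite !inE (EA _ xyE); move: xyE; rewrite inE => /andP[].
rewrite card_in_imset; last first.
  move=> [x y] [x' y'] xyE xyE' /= /setP exy.
  have := EA _ xyE; have := EA _ xyE' => /= y'A yA.
  have /andP[xA _] : (x \in A) && adj x y by move: xyE; rewrite inE.
  have /andP[x'A _] : (x' \in A) && adj x' y' by move: xyE'; rewrite inE.
  have ne (a b : V) : a \in A -> b \notin A -> (a == b) = false.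
    by move=> aA bA; apply/eqP => ab; rewrite -ab aA in bA.
  have := exy x; rewrite !inE eqxx (ne x y') //= orbF => /esym/eqP <-.
  have := exy y; rewrite !inE eqxx orbT [y == x']eq_sym (ne x' y) //=.
  by move=> /esym/eqP <-.
rewrite -sum1_card (eq_bigl (fun p => (p.1 \in A) && adj p.1 p.2)); last first.
  by move=> p; rewrite inE.
rewrite -(pair_big_dep (fun x => x \in A) (fun x y => adj x y) (fun _ _ => 1%N)).
by apply: eq_bigr => x _; rewrite sum1dep_card.
Qed.

(** Sum the local bound over [v]. Double counting turns the sum of [#|I :&: nbhd v|] into the degree
    sum over [I], and the terms with [v \in I] give [l] times the same sum. *)
Lemma hard_core_deg (R : realType) (l : R) : 0 < l ->
  (forall v, 0 < deg adj v)%N ->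
  (\sum_v (1 + ln (deg adj v)%:R + 2 * ln l)) / (1 + l) ^+ 2 *
    (\sum_(I | indep I) l ^+ #|I|) <=
  \sum_(I | indep I) l ^+ #|I| * ((1 + l) * (\sum_(v in I) deg adj v)%:R).
Proof.
have [sym _] := simple; move=> l0 d0; rewrite !mulr_suml.
apply: le_trans (ler_sum _ (fun v _ => local_occupancy R l v l0 (d0 v))) _.
rewrite exchange_big /=; rewrite le_eqVlt; apply/predU1P; left.
apply: eq_bigr => I _; rewrite -mulr_sumr; congr (_ * _).
rewrite big_split /= mulrDl mul1r addrC natr_sum; congr (_ + _).
  rewrite -!natr_sum; congr (_%:R).
  under eq_bigr => v _ do rewrite -sum1_card.
  under [RHS]eq_bigr => v _ do rewrite /deg -sum1_card.
  rewrite (exchange_big_dep (mem I)) /=; last by move=> v w _; rewrite inE => /andP[].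
  by apply: eq_bigr => w wI; apply: eq_bigl => v; rewrite !inE wI sym.
rewrite mulr_sumr [RHS]big_mkcond; apply: eq_bigr => v _.
by case: (v \in I); rewrite ?mulr1 ?mulr0.
Qed.

(** First moment method: if every independent set fell short, the weighted sum would contradict
    [hard_core_deg]. The cube combines its squared denominator with its factor [1 + l]. *)
Lemma exists_indep_deg (R : realType) (l : R) : 0 < l ->
  (forall v, 0 < deg adj v)%N ->
  exists A, independent adj A /\
    (\sum_v (1 + ln (deg adj v)%:R + 2 * ln l)) / (1 + l) ^+ 3 <=
      (\sum_(v in A) deg adj v)%:R.
Proof.
move=> l0 d0; set L := \sum_v _.
have l1 : 0 < 1 + l by rewrite addr_gt0.
have [/exists_inP[A /indepP iA LA]|none] :=
    boolP [exists A in indep, L / (1 + l) ^+ 3 <= (\sum_(v in A) deg adj v)%:R].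
  by exists A.
have := hard_core_deg R l l0 d0; rewrite leNgt => /negP; case.
rewrite -/L mulr_sumr; apply: ltr_sum.
  (* Strictness of the sum needs at least one term; the empty set is independent. *)
  apply/hasP; exists set0; rewrite ?mem_index_enum //.
  by apply/indepP => x y; rewrite inE.
move=> I iI; rewrite [ltRHS]mulrC ltr_pM2l ?exprn_gt0 //.
move: none; rewrite negb_exists_in => /forall_inP/(_ _ iI); rewrite -ltNge.
move=> SL; rewrite mulrC -ltr_pdivlMr //.
rewrite (_ : L / _ / _ = L / (1 + l) ^+ 3) //.
by field; rewrite gt_eqF.
Qed.
End TriangleFree.

(** * From the geometric mean to the choice of constants *)

Lemma ln_prod_gt0 (R : realType) (I : finType) (F : I -> R) :
  (forall i, 0 < F i) -> ln (\prod_i F i) = \sum_i ln (F i).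
Proof.
move=> F0; suff [] : ln (\prod_i F i) = \sum_i ln (F i) /\ 0 < \prod_i F i by [].
elim/big_rec2: _ => [|i s p _ [<- p0]]; first by rewrite ln1.
by rewrite lnM ?posrE // mulr_gt0.
Qed.

Lemma geom_mean_deg_gt0 (R : realType) (V : finType) (adj : rel V) :
  (0 < #|V|)%N -> 0 < geom_mean_deg adj R -> forall v, (0 < deg adj v)%N.
Proof.
move=> V0 G v; rewrite lt0n; apply/eqP => dv0; move: G.
rewrite /geom_mean_deg (bigD1 v) //= dv0 mul0r powR0 ?ltxx //.
by rewrite invr_eq0 pnatr_eq0 -lt0n.
Qed.

Lemma ln_geom_mean_deg (R : realType) (V : finType) (adj : rel V) :
  (forall v, 0 < deg adj v)%N -> ln (geom_mean_deg adj R) = mean_log_deg adj R.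
Proof.
by move=> d0; rewrite ln_powR ln_prod_gt0 // => v; rewrite ltr0n.
Qed.

(** The lower bound serves the main term, the upper bound the possibly negative constant
    [1 + 2 * ln l]. *)
Lemma bernoulli_cube (R : realType) (l : R) :
  0 < l -> 1 - 3 * l <= ((1 + l) ^+ 3)^-1 <= 1.
Proof.
move=> l0; have p0 : 0 < (1 + l) ^+ 3 by rewrite exprn_gt0 // addr_gt0.
apply/andP; split; last by rewrite invf_le1 // exprn_ege1 // lerDl ltW.
rewrite -[leRHS]mul1r ler_pdivlMr // -subr_ge0.
have -> : 1 - (1 - 3 * l) * (1 + l) ^+ 3 = l ^+ 2 * (6 + 8 * l + 3 * l ^+ 2) by ring.
by rewrite mulr_ge0 ?exprn_ge0 ?addr_ge0 ?mulr_ge0 ?exprn_ge0 // ltW.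
Qed.

Theorem theorem5 (R : realType) (eta : R) (eta_gt0 : 0 < eta) :
  exists K : R, 0 < K /\
    forall (V : finType) (adj : rel V),
      simple_graph adj -> triangle_free adj -> (1 <= #|V|)%N ->
      K <= geom_mean_deg adj R ->
      exists A B : {set V},
        semi_bipartite_induced adj A B /\
        (2 - eta) * mean_log_deg adj R <= avg_degree adj R A B.
Proof.
(* With [3 * l = eta / 4] the main coefficient is at least [2 - eta / 2]. The spare [eta / 2] times
   the mean log-degree must absorb [2 * C], whence the exponent [4 * C / eta]. *)
pose l := eta / 12; have l0 : 0 < l by rewrite divr_gt0.
pose C := `|1 + 2 * ln l|.
exists (expR (4 * C / eta)); split=> [|V adj simple tf V0 KG]; first exact: expR_gt0.
have G0 := lt_le_trans (expR_gt0 _) KG.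
have d0 := geom_mean_deg_gt0 R V adj V0 G0.
have {KG G0} mC : 4 * C / eta <= mean_log_deg adj R.
  by rewrite -ln_geom_mean_deg // -[leLHS]expRK ler_ln ?posrE ?expR_gt0.
have [A [iA LA]] := exists_indep_deg V adj simple tf R l l0 d0.
exists A, (~: A); split.
  split=> //; first by rewrite -setI_eq0 setICr.
  by rewrite setUCr -cards_eq0 cardsT -lt0n.
have n0 : 0 < #|V|%:R :> R by rewrite ltr0n.
rewrite /avg_degree cardsC (card_edges_between_setC V adj A iA).
have : 2 * (1 + mean_log_deg adj R + 2 * ln l) / (1 + l) ^+ 3 <=
    2 / #|V|%:R * (\sum_(v in A) deg adj v)%:R.
  apply: le_trans (ler_wpM2l _ LA); last by rewrite divr_ge0.
  have sumc (x : R) : \sum_(v : V) x = #|V|%:R * x by rewrite sumr_const mulr_natl.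
  rewrite !big_split /= !sumc /mean_log_deg.
  set s := \sum_v _; set n : R := _%:R in n0 *.
  rewrite le_eqVlt; apply/predU1P; left.
  field; rewrite !gt_eqF // addr_gt0 //.
apply: le_trans.
have Cle : - C <= 1 + 2 * ln l by rewrite lerNl /C -normrN ler_norm.
have C0 : 0 <= C by exact: normr_ge0.
have m0 : 0 <= mean_log_deg adj R.
  by apply: le_trans mC; rewrite divr_ge0 ?mulr_ge0 // ltW.
have /andP[c1 c2] := bernoulli_cube R l l0.
set c := _^-1 in c1 c2 *; set m := mean_log_deg _ _ in mC m0 *.
have le3 : 3 * l = eta / 4 by rewrite /l; field.
have {mC} mC : 4 * C <= eta * m by rewrite [leRHS]mulrC -ler_pdivrMr.
(* These three products supply the nonlinear terms; the rest is linear. *)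
have : 0 <= m * (c - (1 - 3 * l)) by rewrite mulr_ge0 // subr_ge0.
have : 0 <= C * (1 - c).
  by rewrite mulr_ge0 // subr_ge0.
have : 0 <= c * (1 + 2 * ln l + C).
  by apply: mulr_ge0; [rewrite invr_ge0 exprn_ge0 ?addr_ge0 // ltW | lra].
rewrite le3; lra.
Qed.
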